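(* Every complete bipartite graph $K_{p,q}$ ($p,q\ge 1$) is $S$-determined.
   Context: All graphs are finite and simple. For a graph $G$ with vertices $v_1,\ldots,v_n$, the Seidel matrix $S(G)$ is $J-I-2A(G)$, where $A(G)$ is the adjacency matrix, $J$ the all-ones matrix and $I$ the identity; its eigenvalue multiset is the Seidel spectrum of $G$. For a partition $V(G)=U\cup W$, Seidel switching with respect to $U$ deletes all edges between $U$ and $W$ and adds an edge between $u\in U$, $w\in W$ whenever $uw$ was not an edge. Two graphs are switching equivalent if one is obtained from the other by a Seidel switching. A graph $G$ is $S$-determined (Seidel determined up to switching) if every graph with the same Seidel spectrum as $G$ is switching equivalent to a graph isomorphic to $G$. *)

(* Defs.v *)
From HB Require Import structures.
From mathcomp Require Import all_boot all_order all_algebra all_field.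

Set Implicit Arguments.
Unset Strict Implicit.
Unset Printing Implicit Defensive.

Import GRing.Theory.
Local Open Scope ring_scope.

Record sgraph (T : finType) := SGraph {
  edge :> rel T;
  edge_sym : symmetric edge;
  edge_irr : irreflexive edge
}.

Definition isomorphic (T T' : finType) (G : sgraph T) (H : sgraph T') : Prop :=
  exists2 f : T -> T', bijective f & forall x y, edge H (f x) (f y) = edge G x y.

(* Rows and columns are indexed by the enumeration of the vertex type. *)
Definition adjacency (T : finType) (G : sgraph T) : 'M[algC]_#|T| :=
  \matrix_(i, j) (edge G (enum_val i) (enum_val j))%:R.

Definition seidel (T : finType) (G : sgraph T) : 'M[algC]_#|T| :=
  const_mx 1 - 1%:M - 2%:R *: adjacency G.

(* The eigenvalues with algebraic multiplicity, i.e. the roots of the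
   characteristic polynomial; this sequence is only meaningful up to perm_eq. *)
Definition spectrum (n : nat) (A : 'M[algC]_n) : seq algC :=
  sval (closed_field_poly_normal (char_poly A)).

Lemma spectrumP (n : nat) (A : 'M[algC]_n) :
  char_poly A = \prod_(a <- spectrum A) ('X - a%:P).
Proof.
rewrite /spectrum; case: closed_field_poly_normal => r /= {1}->.
by rewrite (monicP (char_poly_monic A)) scale1r.
Qed.

Lemma mem_spectrum (n : nat) (A : 'M[algC]_n) (a : algC) :
  (a \in spectrum A) = eigenvalue A a.
Proof. by rewrite eigenvalue_root_char spectrumP root_prod_XsubC. Qed.

Definition same_seidel_spectrum (T T' : finType)
    (G : sgraph T) (H : sgraph T') : Prop :=
  perm_eq (spectrum (seidel G)) (spectrum (seidel H)).

Section Switching.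
Variables (T : finType) (G : sgraph T) (U : {set T}).

Definition switch_edge : rel T := fun x y =>
  if (x \in U) == (y \in U) then edge G x y else ~~ edge G x y.

Lemma switch_edge_sym : symmetric switch_edge.
Proof. by move=> x y; rewrite /switch_edge eq_sym edge_sym. Qed.

Lemma switch_edge_irr : irreflexive switch_edge.
Proof. by move=> x; rewrite /switch_edge eqxx edge_irr. Qed.

Definition switch : sgraph T := SGraph switch_edge_sym switch_edge_irr.

End Switching.

(* U and its complement may be empty, so that the relation is reflexive. *)
Definition switching_equivalent (T : finType) (G H : sgraph T) : Prop :=
  exists U : {set T}, edge H =2 edge (switch G U).

Definition S_determined (T : finType) (G : sgraph T) : Prop :=
  forall (T' : finType) (H : sgraph T'), same_seidel_spectrum H G ->
  exists2 G' : sgraph T', switching_equivalent H G' & isomorphic G' G.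

Section CompleteBipartite.
Variables p q : nat.

Definition cb_edge : rel ('I_p + 'I_q)%type := fun x y =>
  match x, y with
  | inl _, inr _ | inr _, inl _ => true
  | _, _ => false
  end.

Lemma cb_edge_sym : symmetric cb_edge.
Proof. by case=> ? []. Qed.

Lemma cb_edge_irr : irreflexive cb_edge.
Proof. by case. Qed.

Definition complete_bipartite : sgraph ('I_p + 'I_q)%type :=
  SGraph cb_edge_sym cb_edge_irr.

End CompleteBipartite.

(* Main.v *)
Require Import Defs.
From mathcomp Require Import all_boot all_order all_algebra all_field.

(** Write [M = S + I], a symmetric matrix with entries [1] and [-1].  For
    [K_{p,q}] it has rank one, so [M ^ 2 = n M] and every Seidel eigenvalue is a
    root of [Q = (x + 1) (x + 1 - n)].  If [H] has the same spectrum then, by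
    Cayley-Hamilton, [Q (S (H))] is nilpotent; being real symmetric, it is [0].
    Thus [\sum_k M_ik M_kj = n M_ij] for [M = S (H) + I], which for signs forces
    [M_ij = M_ik M_kj] for all [i], [j], [k].  Hence [H] is complete bipartite,
    possibly with an empty part, and all such graphs on [n] vertices are
    switching equivalent. *)

Set Implicit Arguments.
Unset Strict Implicit.
Unset Printing Implicit Defensive.

Import Order.TTheory GRing.Theory Num.Theory.
Local Open Scope ring_scope.

(** By symmetry, the [i]-th diagonal entry of [A *m A] is the sum of the squares of the real entries
    in row [i]. *)
Lemma real_symmetric_sqr_eq0 (n : nat) (A : 'M[algC]_n) :
  A^T = A -> A \is a mxOver Num.real -> A *m A = 0 -> A = 0.
Proof.
move=> symA /mxOverP realA A2; apply/matrixP=> i j; rewrite mxE.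
have : (A *m A) i i = 0 by rewrite A2 mxE.
rewrite mxE => sum0.
have sq k : A i k * A k i = A i k ^+ 2.
  by rewrite -{2}symA mxE expr2.
have /(_ j isT) : forall k, true -> A i k * A k i = 0.
  move=> k _; move: sum0 => /psumr_eq0P; apply=> // l _.
  by rewrite sq real_exprn_even_ge0.
by rewrite sq => /eqP; rewrite sqrf_eq0 => /eqP.
Qed.

Lemma real_symmetric_nilpotent_eq0 (n k : nat) (A : 'M[algC]_n.+1) :
  A^T = A -> A \is a mxOver Num.real -> A ^+ k = 0 -> A = 0.
Proof.
move=> symA realA Ak0.
(* Raise the exponent to a power of two, then halve it repeatedly: each [A ^+ (2 ^ k)] is again real
   symmetric, so it vanishes once its square does. *)
have {Ak0} : A ^+ (2 ^ k) = 0.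
  by rewrite -(subnK (ltnW (ltn_expl k (ltnSn 1)))) exprD Ak0 mulr0.
elim: k => [|k IHk]; first by rewrite expn0 expr1.
rewrite expnS mulnC exprM => A2; apply: IHk.
apply: real_symmetric_sqr_eq0 => //.
  by elim: (2 ^ k)%N => [|m IHm]; rewrite ?expr0 ?trmx1 // exprS trmx_mul IHm
    symA -[_ *m _]/(_ * _) -exprSr exprS.
elim: (2 ^ k)%N => [|m IHm]; last by rewrite exprS mxOverM.
by rewrite expr0 mxOver_scalar ?rpred0 ?rpred1.
Qed.

Lemma real_symmetric_quadratic (n : nat) (A : 'M[algC]_n) (a b : algC) :
    A^T = A -> A \is a mxOver Num.real -> a \is Num.real -> b \is Num.real ->
    {in spectrum A, forall x, (x - a) * (x - b) = 0} ->
  (A - a%:M) *m (A - b%:M) = 0.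
Proof.
case: n A => [|n] A symA realA ra rb specA; first by rewrite [LHS]flatmx0.
pose Q : {poly algC} := ('X - a%:P) * ('X - b%:P).
have QA : horner_mx A Q = (A - a%:M) *m (A - b%:M).
  by rewrite rmorphM !rmorphB /= horner_mx_X !horner_mx_C.
have realB c : c \is Num.real -> A - c%:M \is a mxOver Num.real.
  move=> rc; apply/mxOverP=> i j; rewrite !mxE rpredB ?(mxOverP realA) //.
  by rewrite rpredMn.
have symB c : (A - c%:M)^T = A - c%:M by rewrite linearB /= symA tr_scalar_mx.
apply: (@real_symmetric_nilpotent_eq0 _ (size (spectrum A))).
(* Transposing swaps the two factors; they commute, being polynomials in [A]. *)
- rewrite trmx_mul !symB -QA /Q mulrC.
  by rewrite rmorphM !rmorphB /= horner_mx_X !horner_mx_C.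
- by rewrite mxOverM ?realB.
(* Each linear factor of [char_poly A] divides one copy of [Q]. *)
have /dvdpP[R QR] : char_poly A %| Q ^+ size (spectrum A).
  rewrite spectrumP; move: specA; elim: (spectrum A) => [|x s IHs] specA.
    by rewrite big_nil dvd1p.
  rewrite big_cons /= exprS dvdp_mul //; last first.
    by apply: IHs => y ys; apply: specA; rewrite inE ys orbT.
  by rewrite dvdp_XsubCl /root /Q !hornerE specA // inE eqxx.
by rewrite -QA -rmorphXn QR rmorphM /= Cayley_Hamilton mulr0.
Qed.

Lemma size_spectrum (n : nat) (A : 'M[algC]_n) : size (spectrum A) = n.
Proof.
by apply: succn_inj; rewrite -(size_char_poly A) spectrumP size_prod_XsubC.
Qed.

Section SeidelSign.
Variables (T : finType) (G : sgraph T).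

Lemma seidel_add1E (i j : 'I_#|T|) :
  (seidel G - (-1)%:M) i j = (-1) ^+ edge G (enum_val i) (enum_val j).
Proof.
rewrite !mxE mulNrn opprK addrAC subrK.
by case: edge; rewrite ?mulr1 ?mulr0 ?subr0 // opprD addrA subrr add0r.
Qed.

Lemma seidel_tr : (seidel G)^T = seidel G.
Proof. by apply/matrixP=> i j; rewrite !mxE edge_sym eq_sym. Qed.

Lemma seidel_real : seidel G \is a mxOver Num.real.
Proof.
by apply/mxOverP=> i j; rewrite !mxE !rpredB ?rpredM ?rpred_nat ?rpred1.
Qed.

Lemma seidel_bipartition_spectrum (s : T -> bool) :
    edge G =2 (fun x y => s x (+) s y) ->
  {in spectrum (seidel G),
    forall a, (a - (-1)) * (a - (#|T|%:R - 1)) = 0}.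
Proof.
move=> Gs a; rewrite mem_spectrum => /eigenvalueP[v vS v0].
pose M := seidel G - (-1)%:M.
have vM : v *m M = (a + 1) *: v.
  by rewrite mulmxBr vS mul_mx_scalar scaleN1r opprK scalerDl scale1r.
(* The sign of the middle vertex occurs twice and cancels, so all [#|T|] terms equal [M i j]. *)
have MM : M *m M = #|T|%:R *: M.
  apply/matrixP=> i j; rewrite mxE [RHS]mxE.
  under eq_bigr => k _.
    rewrite !seidel_add1E !Gs -signr_addb addbA -(addbA (s _)) addbb addbF.
    over.
  by rewrite sumr_const card_ord seidel_add1E Gs mulr_natl.
have : v *m (M *m M) = v *m (#|T|%:R *: M) by rewrite MM.
rewrite mulmxA vM -scalemxAr -scalemxAl vM !scalerA => /eqP.
rewrite -subr_eq0 -scalerBl scaler_eq0 (negPf v0) orbF => /eqP <-.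
by rewrite opprK opprB addrA mulrBr mulrC [_ * #|T|%:R]mulrC.
Qed.

(* A sum of [#|T|] signs equal to [#|T|] times a sign has all its terms equal. *)
Lemma seidel_quadratic_bipartition (x0 : T) :
    (seidel G - (-1)%:M) *m (seidel G - (#|T|%:R - 1)%:M) = 0 ->
  edge G =2 (fun x y => edge G x0 x (+) edge G x0 y).
Proof.
pose M := seidel G - (-1)%:M => MM x y.
have {}MM : M *m M = #|T|%:R *: M.
  apply/eqP; rewrite -subr_eq0 -mul_mx_scalar -mulmxBr; apply/eqP.
  by rewrite -MM /M [(#|T|%:R - 1)%:M]raddfB raddfN /= opprB opprK addrA.
pose e u v : algC := (-1) ^+ edge G u v.
have eM u v : e u v = M (enum_rank u) (enum_rank v).
  by rewrite seidel_add1E !enum_rankK.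
(* Each [d k] is [0] or [2], and [MM] makes their sum [0]; the term at [x0] then gives the claim. *)
pose d (k : 'I_#|T|) := 1 - e x y * (e x (enum_val k) * e (enum_val k) y).
have sum_d : \sum_k d k = 0.
  move/matrixP: MM => /(_ (enum_rank x) (enum_rank y)).
  rewrite mxE [RHS]mxE -eM => MM.
  rewrite sumrB sumr_const card_ord -mulr_sumr.
  under eq_bigr => k _ do rewrite !eM enum_valK.
  by rewrite MM mulrCA -expr2 sqrr_sign mulr1 subrr.
have d_ge0 k : true -> 0 <= d k.
  rewrite /d /e -!signr_addb subr_ge0; case: (_ (+) _) => //=.
  by rewrite expr1 (le_trans (lerN10 _) ler01).
have /eqP := psumr_eq0P d_ge0 sum_d (i := enum_rank x0) isT.
rewrite /d /e enum_rankK [edge G x x0]edge_sym -!signr_addb.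
by case: (edge G x y); case: (_ x (+) _ y) => //=; rewrite expr1 opprK (eqr_nat _ 2 0).
Qed.

End SeidelSign.

Lemma bipartitions_switching_equivalent (T : finType) (G H : sgraph T)
    (g h : T -> bool) :
    edge G =2 (fun x y => g x (+) g y) -> edge H =2 (fun x y => h x (+) h y) ->
  switching_equivalent G H.
Proof.
(* Switch at the vertices where the two colourings disagree. *)
move=> Gg Hh; exists [set x | g x (+) h x] => x y.
rewrite Hh /= /switch_edge !inE Gg.
by case: (g x); case: (g y); case: (h x); case: (h y).
Qed.

(** Switching equivalence compares graphs on one vertex type, so [K_{p,q}] has to be carried over to
    the vertices of [H]. *)
Definition pullback_graph (T T' : finType) (f : T -> T') (G : sgraph T') :
    sgraph T :=
  SGraph (fun x y => edge_sym G (f x) (f y)) (fun x => edge_irr G (f x)).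

Definition is_inl (A B : Type) (x : A + B) : bool :=
  if x is inl _ then true else false.

Lemma cb_edgeE (p q : nat) :
  edge (complete_bipartite p q) =2 (fun x y => is_inl x (+) is_inl y).
Proof. by case=> ? []. Qed.

Local Close Scope ring_scope.

Theorem theorem3p6 (p q : nat) (hp : 1 <= p) (hq : 1 <= q) :
  S_determined (complete_bipartite p q).
Proof.
move=> T H specH; have cardT : #|T| = #|{: 'I_p + 'I_q}|.
  by rewrite -(size_spectrum (seidel H)) (perm_size specH) size_spectrum.
have x0 : T.
  have : (0 < #|T|)%N by rewrite cardT card_sum !card_ord addn_gt0 hp.
  by case/card_gt0P/sigW.
have Hbip : edge H =2 (fun x y => edge H x0 x (+) edge H x0 y).
  apply: seidel_quadratic_bipartition; apply: real_symmetric_quadratic.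
  - exact: seidel_tr.
  - exact: seidel_real.
  - by rewrite rpredN rpred1.
  - by rewrite rpredB ?rpred_nat ?rpred1.
  move=> a; rewrite (perm_mem specH) cardT.
  exact: (seidel_bipartition_spectrum (@cb_edgeE p q)).
(* Any bijection serves: the parts of [H] need not match those of [K_{p,q}], since switching relates
   all bipartitions. *)
pose f (x : T) : ('I_p + 'I_q)%type := enum_val (cast_ord cardT (enum_rank x)).
have f_bij : bijective f.
  exists (fun y => enum_val (cast_ord (esym cardT) (enum_rank y))) => z.
    by rewrite /f enum_valK cast_ordK enum_rankK.
  by rewrite /f enum_valK cast_ordKV enum_rankK.
exists (pullback_graph f (complete_bipartite p q)); last by exists f.
apply: (@bipartitions_switching_equivalent _ _ _ (edge H x0)
  (fun x => is_inl (f x))) => // x y; exact: cb_edgeE.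
Qed.
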